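(* Let $\mu_o\in\mathbb{R}$ be a constant, let $r\ge 0$ be an integer, and let $M$ be an $n$-dimensional hypersurface in Euclidean space $E^{n+1}$ with unit normal field $\nu$ and position vector $\psi=(\psi_1,\dots,\psi_{n+1})$. Then $M$ is $\sigma_r^\infty$-minimal if and only if each component of its position vector satisfies the partial differential equation $$(T_r^\infty)^{ij}\psi_{,ij}=0,$$ or, in divergence form, $$\big((T_r^\infty)^{ij}\psi_{,i}\big)_{,j}=0 .$$
   Context: For a real number $\mu_o$ and a symmetric endomorphism $A$, $\sigma_k(A)$ is the $k$-th elementary symmetric polynomial of the eigenvalues of $A$; $\sigma_k^\infty(\mu_o,A)=\sum_{j=0}^k\frac{\mu_o^j}{j!}\sigma_{k-j}(A)$ and $T_k^\infty(\mu_o,A)=\sum_{j=0}^k(-1)^j\sigma_{k-j}^\infty(\mu_o,A)A^j$. For the hypersurface, $A$ is the shape operator $A_i^j=g^{jk}A_{ik}$ with $A_{ik}=\langle\overline\nabla_{\partial/\partial x_i}\frac{\partial\psi}{\partial x_k},\nu\rangle$, where $g$ is the induced metric and $\overline\nabla$ is the flat connection of $E^{n+1}$; $\sigma_k^\infty=\sigma_k^\infty(\mu_o,A)$ and $T_k^\infty=T_k^\infty(\mu_o,A)$, with indices raised by $g$. A comma denotes covariant differentiation on $M$ with respect to $g$ (applied componentwise to $\psi$, so $\psi_{,ij}$ is the Hessian of each component function). Repeated indices are summed. Definition: a hypersurface in Euclidean space is $\sigma_r^\infty$-minimal if $(r+1)\sigma_{r+1}^\infty-\mu_o\sigma_r^\infty$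 vanishes identically. *)

(* Defs.v *)
From HB Require Import structures.
From mathcomp Require Import all_boot all_order all_algebra.
From mathcomp Require Import all_classical all_reals all_analysis.
(* Not imported: its notations clash with those of mathcomp-analysis. *)
From mathcomp Require mpoly.

Set Implicit Arguments.
Unset Strict Implicit.
Unset Printing Implicit Defensive.

Import Order.TTheory GRing.Theory Num.Theory.
Import numFieldNormedType.Exports.

Local Open Scope classical_set_scope.
Local Open Scope ring_scope.

Section Symmetric_functions.
Variables (R : realType) (n : nat).
Implicit Types (A : 'M[R]_n) (mu : R).

(* The eigenvalues with multiplicity, in an arbitrary order.  They exist in R
   when A is self-adjoint for some inner product; the default is only reached
   when the characteristic polynomial does not split over R. *)
Definition eigenvals A : n.-tuple R :=
  xget (nseq_tuple n 0)
    [set s : n.-tuple R | char_poly A = \prod_(x <- s) ('X - x%:P)].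

Definition sigma (k : nat) A : R :=
  mpoly.meval (tnth (eigenvals A)) (mpoly.mesym n R k).

Definition sigma_inf mu (k : nat) A : R :=
  \sum_(j < k.+1) mu ^+ j / (j`!)%:R * sigma (k - j) A.

Definition T_inf mu (k : nat) A : 'M[R]_n :=
  \sum_(j < k.+1) ((-1) ^+ j * sigma_inf mu (k - j) A) *: A ^+ j.

End Symmetric_functions.

Section Calculus.
Variables (R : realType) (n : nat).

Definition partial (i : 'I_n) (f : 'rV[R]_n -> R) : 'rV[R]_n -> R :=
  fun x => 'D_('e_i) f x.

Definition vpartial m (i : 'I_n) (F : 'rV[R]_n -> 'rV[R]_m) :
    'rV[R]_n -> 'rV[R]_m :=
  fun x => \row_a partial i (fun y => F y 0 a) x.

(* C^infty on the open set U: f and all its iterated partial derivatives are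
   (Frechet) differentiable at every point of U. *)
Definition smooth_on (U : set 'rV[R]_n) (f : 'rV[R]_n -> R) : Prop :=
  forall (s : seq 'I_n) x, U x -> differentiable (foldr partial f s) x.

Definition dot (u v : 'rV[R]_n) : R := (u *m v^T) 0 0.

End Calculus.

(* A chart is given by its domain, the coordinate map and its inverse; the
   values of the two maps outside dom and map @` dom are irrelevant. *)
Record chart (R : realType) (n : nat) (M : topologicalType) := Chart {
  chart_dom : set M;
  chart_map : M -> 'rV[R]_n;
  chart_inv : 'rV[R]_n -> M;
  chart_dom_open : open chart_dom;
  chart_img_open : open (chart_map @` chart_dom);
  chart_mapK : {in chart_dom, cancel chart_map chart_inv};
  chart_map_cts : {within chart_dom, continuous chart_map};
  chart_inv_cts : {within chart_map @` chart_dom, continuous chart_inv} }.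

Definition chart_img R n M (c : @chart R n M) : set 'rV[R]_n :=
  chart_map c @` chart_dom c.

Record manifold (R : realType) (n : nat) := Manifold {
  carrier :> topologicalType;
  atlas : set (chart R n carrier);
  manifold_hausdorff : hausdorff_space carrier;
  manifold_countable : @second_countable carrier;
  atlas_cover : forall p, exists2 c, atlas c & chart_dom c p;
  atlas_smooth : forall c c', atlas c -> atlas c' -> forall j,
    smooth_on (chart_map c @` (chart_dom c `&` chart_dom c'))
      (fun x => chart_map c' (chart_inv c x) 0 j) }.

Section Maps.
Variables (R : realType) (n : nat) (M : manifold R n) (m : nat).
Variable F : M -> 'rV[R]_m.

Definition in_chart (c : chart R n M) : 'rV[R]_n -> 'rV[R]_m :=
  F \o chart_inv c.

Definition smooth_map : Prop := forall c, atlas c -> forall a,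
  smooth_on (chart_img c) (fun x => in_chart c x 0 a).

Definition immersion : Prop := forall c, atlas c -> forall x, chart_img c x ->
  row_free (\matrix_(i < n) vpartial i (in_chart c) x).

End Maps.

Record hypersurface (R : realType) (n : nat) := Hypersurface {
  mfd :> manifold R n;
  position : mfd -> 'rV[R]_n.+1;
  unit_normal : mfd -> 'rV[R]_n.+1;
  position_smooth : smooth_map position;
  position_immersion : immersion position;
  normal_smooth : smooth_map unit_normal;
  normal_unit : forall p, dot (unit_normal p) (unit_normal p) = 1;
  normal_orth : forall c, atlas c -> forall x, chart_img c x -> forall i,
    dot (vpartial i (in_chart position c) x) (in_chart unit_normal c x) = 0 }.

(* Local expressions: X is the position vector and N the unit normal field,
   as functions of the coordinates in some chart. *)
Section Local_geometry.
Variables (R : realType) (n : nat) (X N : 'rV[R]_n -> 'rV[R]_n.+1).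

Definition metric (x : 'rV[R]_n) : 'M[R]_n :=
  \matrix_(i, j) dot (vpartial i X x) (vpartial j X x).

Definition metric_inv (x : 'rV[R]_n) : 'M[R]_n := invmx (metric x).

(* Gamma^k_{ij} *)
Definition christoffel (k i j : 'I_n) (x : 'rV[R]_n) : R :=
  2^-1 * \sum_l metric_inv x k l *
    (partial i (fun y => metric y j l) x + partial j (fun y => metric y i l) x
     - partial l (fun y => metric y i j) x).

Definition second_form (i k : 'I_n) (x : 'rV[R]_n) : R :=
  dot (vpartial i (vpartial k X) x) (N x).

(* A_i^j is the entry in row i and column j. *)
Definition shape_op (x : 'rV[R]_n) : 'M[R]_n :=
  \matrix_(i, j) \sum_k metric_inv x j k * second_form i k x.

(* (T_r^infty)^{ij} *)
Definition T_up (mu : R) (r : nat) (i j : 'I_n) (x : 'rV[R]_n) : R :=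
  \sum_k metric_inv x i k * T_inf mu r (shape_op x) k j.

(* f_{,ij} *)
Definition hess (f : 'rV[R]_n -> R) (i j : 'I_n) (x : 'rV[R]_n) : R :=
  partial j (partial i f) x - \sum_k christoffel k i j x * partial k f x.

(* V^j_{,l} *)
Definition cov_vec (V : 'I_n -> 'rV[R]_n -> R) (j l : 'I_n)
    (x : 'rV[R]_n) : R :=
  partial l (V j) x + \sum_k christoffel j l k x * V k x.

Definition T_hess (mu : R) (r : nat) (f : 'rV[R]_n -> R) (x : 'rV[R]_n) : R :=
  \sum_i \sum_j T_up mu r i j x * hess f i j x.

Definition T_div (mu : R) (r : nat) (f : 'rV[R]_n -> R) (x : 'rV[R]_n) : R :=
  \sum_j cov_vec (fun k y => \sum_i T_up mu r i k y * partial i f y) j j x.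

End Local_geometry.

Section Equations.
Variables (R : realType) (n : nat) (mu : R) (r : nat) (M : hypersurface R n).

Local Notation X c := (in_chart (@position R n M) c).
Local Notation N c := (in_chart (@unit_normal R n M) c).

Definition sigma_inf_minimal : Prop :=
  forall c, atlas c -> forall x, chart_img c x ->
    r.+1%:R * sigma_inf mu r.+1 (shape_op (X c) (N c) x)
    - mu * sigma_inf mu r (shape_op (X c) (N c) x) = 0.

Definition position_hess_eq (a : 'I_n.+1) : Prop :=
  forall c, atlas c -> forall x, chart_img c x ->
    T_hess (X c) (N c) mu r (fun y => X c y 0 a) x = 0.

Definition position_div_eq (a : 'I_n.+1) : Prop :=
  forall c, atlas c -> forall x, chart_img c x ->
    T_div (X c) (N c) mu r (fun y => X c y 0 a) x = 0.

End Equations.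

(* Main.v *)
(* Let J be the matrix of tangent vectors of the hypersurface, g = J J^T, h the
   second fundamental form and A = h g^-1.  Gauss' formula psi_{,ij} = h_ij nu
   gives T^{ij} psi_{,ij} = tr (A T) nu, and tr (A T_r) = (r + 1) sigma_{r+1} -
   mu sigma_r, so the first equivalence holds because nu is a unit vector.  For
   the divergence form, T^{ij}_{,j} = 0: from T_{k+1} = sigma_{k+1} - A T_k, the
   variation formula d sigma_{k+1} = tr (T_k dA) and the Codazzi equations, by
   induction on k.  All facts about sigma_k and T_k come from the coefficients
   in t of det (1 + t A) and of its adjugate, which avoids differentiating
   eigenvalues. *)

Require Import Defs.
From HB Require Import structures.
From mathcomp Require Import all_boot all_order all_algebra.
From mathcomp Require Import all_classical all_reals all_analysis.
From mathcomp Require Import perm ring lra complex.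
From mathcomp Require mpoly.

Set Implicit Arguments.
Unset Strict Implicit.
Unset Printing Implicit Defensive.

Import Order.TTheory GRing.Theory Num.Theory.
Import numFieldNormedType.Exports.

Local Open Scope classical_set_scope.
Local Open Scope ring_scope.

(** * Newton transformations *)

(* A relation instead of a function, to cover both the formal derivative of
   polynomials and the directional derivative of functions differentiable at x.
   Only the constants 0, 1 and -1 are required to have derivative 0: for formal
   derivatives U is unit, and every element is a constant family. *)
Section Derivation_rules.
Variables (U : Type) (S : comNzRingType) (x : U).
Variable der : (U -> S) -> S -> Prop.
Hypothesis der0 : der (fun=> 0) 0.
Hypothesis der_sign : forall b : bool, der (fun=> (-1) ^+ b) 0.
Hypothesis derD : forall f g a b,
  der f a -> der g b -> der (fun u => f u + g u) (a + b).
Hypothesis derM : forall f g a b,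
  der f a -> der g b -> der (fun u => f u * g u) (a * g x + f x * b).

Lemma der_sum (I : Type) (r : seq I) (F : I -> U -> S) (F' : I -> S) :
  (forall i, der (F i) (F' i)) ->
  der (fun u => \sum_(i <- r) F i u) (\sum_(i <- r) F' i).
Proof.
move=> dF; elim: r => [|i r IH].
  rewrite big_nil; under eq_fun do rewrite big_nil; exact: der0.
by rewrite big_cons; under eq_fun do rewrite big_cons; exact: derD.
Qed.

(** The differentiated factor is singled out by its index, so a repeated index would have several
    factors differentiated at once; hence [uniq]. *)
Lemma der_prod (I : eqType) (r : seq I) (F : I -> U -> S) (F' : I -> S) :
  uniq r -> (forall i, der (F i) (F' i)) ->
  der (fun u => \prod_(i <- r) F i u)
      (\sum_(i <- r) \prod_(j <- r) if j == i then F' j else F j x).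
Proof.
move=> + dF; elim: r => [_|i r IH /= /andP[ir ur]].
  rewrite big_nil; under eq_fun do rewrite big_nil; exact: (der_sign false).
under eq_fun do rewrite big_cons.
rewrite big_cons big_cons eqxx [X in F' i * X](_ : _ = \prod_(j <- r) F j x).
  rewrite [X in _ + X](_ : _ = F i x *
      \sum_(k <- r) \prod_(j <- r) if j == k then F' j else F j x).
    exact: derM (IH ur).
  rewrite big_distrr /=; apply: eq_big_seq => k kr.
  by rewrite big_cons; case: eqP ir => // ->; rewrite kr.
by apply: eq_big_seq => k kr; case: eqP ir => // <-; rewrite kr.
Qed.

(** Jacobi's formula: the product rule in the Leibniz expansion differentiates one row at a time,
    and expansion along that row produces the cofactors. *)
Lemma der_det n (M : U -> 'M[S]_n) (M' : 'M[S]_n) :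
  (forall i j, der (fun u => M u i j) (M' i j)) ->
  der (fun u => \det (M u)) (\tr (M' *m \adj (M x))).
Proof.
move=> dM.
(* [N i] is [M x] with row i replaced by row i of the derivative. *)
pose N i := \matrix_(j, k) if j == i then M' j k else M x j k.
have -> : \tr (M' *m \adj (M x)) = \sum_i \det (N i).
  apply: eq_bigr => i _; rewrite mxE (expand_det_row _ i).
  apply: eq_bigr => k _; rewrite !mxE eqxx; congr (_ * _).
  congr (_ * \det _); apply/matrixP => a b; rewrite !mxE.
  by rewrite eq_sym (negPf (neq_lift _ _)).
rewrite /determinant exchange_big /=.
apply: der_sum => s; rewrite -mulr_sumr.
have := derM (der_sign s) (@der_prod _ (index_enum _)
  (fun i u => M u i (s i)) (fun i => M' i (s i)) (index_enum_uniq _)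
  (fun i => dM i (s i))).
rewrite mul0r add0r; congr der; congr (_ * _).
by apply: eq_bigr => i _; apply: eq_bigr => j _; rewrite mxE.
Qed.

End Derivation_rules.

(** * Newton transformations as coefficients of an adjugate *)

Section Det_one_plus.
Variables (S : comNzRingType) (n : nat).
Implicit Types (A B : 'M[S]_n) (k : nat).

(* The k-th elementary symmetric function of the eigenvalues is the coefficient
   of 'X^k in the determinant of onePX A, and the k-th Newton transformation is
   that of its adjugate. *)
Definition onePX A : 'M[{poly S}]_n := 1%:M + 'X *: map_mx polyC A.

Definition esigma k A : S := (\det (onePX A))`_k.

Definition newton k A : 'M[S]_n := map_mx (coefp k) (\adj (onePX A)).

Lemma mul_onePX_coef A (B : 'M[{poly S}]_n) k :
  map_mx (coefp k.+1) (onePX A *m B) =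
  map_mx (coefp k.+1) B + A *m map_mx (coefp k) B.
Proof.
apply/matrixP => i j; rewrite mulmxDl mul1mx -scalemxAl !mxE /= coefD coefXM /=.
rewrite coef_sum; congr (_ + _); apply: eq_bigr => l _.
by rewrite !mxE coefCM.
Qed.

Lemma map_coef_scalar (p : {poly S}) k :
  map_mx (coefp k) (p%:M : 'M[{poly S}]_n) = (p`_k)%:M.
Proof. by apply/matrixP => i j; rewrite !mxE /= coefMn. Qed.

(** Compare the coefficients of X^(k+1) in (1 + X A) adj (1 + X A) = det (1 + X A). *)
Lemma newtonS k A : newton k.+1 A = (esigma k.+1 A)%:M - A *m newton k A.
Proof.
have := mul_onePX_coef A (\adj (onePX A)) k.
by rewrite mul_mx_adj map_coef_scalar /newton /esigma => ->; rewrite addrK.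
Qed.

Lemma esigma0 A : esigma 0 A = 1.
Proof.
rewrite /esigma -horner_coef0 -[_.[0]]/(horner_eval 0 _) -det_map_mx.
rewrite (_ : map_mx _ _ = 1%:M) ?det1 //; apply/matrixP => i j.
by rewrite !mxE /= /horner_eval hornerD hornerM hornerX mul0r addr0 hornerMn hornerC.
Qed.

Lemma newton0 A : newton 0 A = 1%:M.
Proof.
have := mul_mx_adj (onePX A) => /(congr1 (map_mx (coefp 0))).
rewrite map_coef_scalar -/(esigma _ _) esigma0 => <-.
apply/matrixP => i j; rewrite mulmxDl mul1mx -scalemxAl !mxE /=.
by rewrite coefD coefXM /= addr0.
Qed.

Lemma newton_comm k A : A *m newton k A = newton k A *m A.
Proof.
elim: k => [|k IH]; first by rewrite newton0 mulmx1 mul1mx.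
by rewrite newtonS mulmxBr mulmxBl scalar_mxC -mulmxA -IH.
Qed.

(** Coefficient of X^k in Jacobi's formula d/dX det (1 + X A) = tr (A adj (1 + X A)), for the formal
    derivative. *)
Lemma mxtrace_newton k A : \tr (A *m newton k A) = k.+1%:R * esigma k.+1 A.
Proof.
have dE : (\det (onePX A))^`() = \tr (map_mx polyC A *m \adj (onePX A)).
  apply: (@der_det unit {poly S} tt (fun f a => (f tt)^`() = a) _ _ _ _ _
    (fun=> onePX A)) => // [|b|f g a b <- <-|f g a b <- <-|i j].
  - exact: derivC.
  - by case: b; rewrite /= ?expr0 ?expr1 ?derivN derivC ?oppr0.
  - by rewrite derivD.
  - by rewrite derivM.
  - by rewrite !mxE derivD derivM derivX derivC derivMn derivC mul0rn mulr0
      add0r addr0 mul1r.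
have := congr1 (coefp k) dE; rewrite /= coef_deriv mulr_natl => ->.
rewrite /mxtrace coef_sum; apply: eq_bigr => i _.
rewrite !mxE coef_sum; apply: eq_bigr => l _.
by rewrite !mxE coefCM.
Qed.

End Det_one_plus.

(** * Symmetric functions and Newton transformations weighted by mu *)

Section Weighted.
Variables (R : numFieldType) (n : nat) (mu : R).
Implicit Types (A : 'M[R]_n) (k : nat).

(** Together with [newton_inf]: the coefficients of t^k in exp (mu t) det (1 + t A) and exp (mu t)
    adj (1 + t A). *)
Definition esigma_inf k A : R :=
  \sum_(j < k.+1) mu ^+ j / (j`!)%:R * esigma (k - j) A.

Definition newton_inf k A : 'M[R]_n :=
  \sum_(j < k.+1) (mu ^+ j / (j`!)%:R) *: newton (k - j) A.

Lemma esigma_inf0 A : esigma_inf 0 A = 1.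
Proof. by rewrite /esigma_inf big_ord1 expr0 fact0 divr1 mul1r esigma0. Qed.

Lemma newton_inf0 A : newton_inf 0 A = 1%:M.
Proof. by rewrite /newton_inf big_ord1 expr0 fact0 divr1 scale1r newton0. Qed.

Lemma newton_infS k A :
  newton_inf k.+1 A = (esigma_inf k.+1 A)%:M - A *m newton_inf k A.
Proof.
(* The last terms on both sides are the scalar mu^(k+1) / (k+1)!; the others match by [newtonS]. *)
rewrite /newton_inf /esigma_inf big_ord_recr [in RHS]big_ord_recr /=.
rewrite subnn newton0 esigma0 mulr1 scalemx1 [in RHS]raddfD /=.
rewrite [in RHS]addrAC; congr (_ + _).
rewrite mulmx_sumr raddf_sum -sumrB; apply: eq_bigr => j _ /=.
rewrite subSn ?leq_ord // newtonS scalerBr scale_scalar_mx.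
by rewrite -scalemxAr.
Qed.

Lemma newton_inf_comm k A : A *m newton_inf k A = newton_inf k A *m A.
Proof.
rewrite mulmx_sumr mulmx_suml; apply: eq_bigr => j _.
by rewrite -scalemxAr newton_comm scalemxAl.
Qed.

(** Unrolling the recursion [newton_infS] gives the alternating sum by which [T_inf] is defined. *)
Lemma newton_infE k A :
  newton_inf k A = \sum_(j < k.+1) ((-1) ^+ j * esigma_inf (k - j) A) *: A ^+ j.
Proof.
elim: k => [|k IH].
  by rewrite newton_inf0 big_ord1 mul1r esigma_inf0 scale1r.
rewrite newton_infS IH [in RHS]big_ord_recl; congr (_ + _).
  by rewrite !expr0 mul1r subn0 -scalemx1.
rewrite mulmx_sumr -sumrN; apply: eq_bigr => j _.
by rewrite -scalemxAr exprS mulN1r mulNr scaleNr -[A *m _]/(A * _) -exprS.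
Qed.

(** Since j mu^j / j! = mu mu^(j-1) / (j-1)!, subtracting mu sigma_k changes the weight k + 1 of the
    j-th term of sigma_(k+1) into k + 1 - j, the weight given by [mxtrace_newton]. *)
Lemma mxtrace_newton_inf k A :
  \tr (A *m newton_inf k A) = k.+1%:R * esigma_inf k.+1 A - mu * esigma_inf k A.
Proof.
have -> : mu * esigma_inf k A =
    \sum_(j < k.+2) j%:R * (mu ^+ j / (j`!)%:R * esigma (k.+1 - j) A).
  rewrite big_ord_recl mul0r add0r mulr_sumr; apply: eq_bigr => j _.
  rewrite lift0 subSS factS natrM exprS.
  by field; rewrite pnatr_eq0 -lt0n fact_gt0 nat1r pnatr_eq0.
(* For j = k + 1 the two weights cancel. *)
rewrite mulr_sumr -sumrB big_ord_recr /= subrr addr0.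
rewrite mulmx_sumr raddf_sum /=; apply: eq_bigr => j _.
rewrite -scalemxAr mxtraceZ mxtrace_newton -mulrBl.
rewrite -natrB 1?ltnW // subSn ?leq_ord //.
by rewrite mulrCA.
Qed.

End Weighted.

(** The difference vanishes at 1, 2, ..., [size (p - q)], which are too many roots. *)
Lemma poly_eq_off0 (R : numDomainType) (p q : {poly R}) :
  (forall t : R, t != 0 -> p.[t] = q.[t]) -> p = q.
Proof.
move=> pq; apply/subr0_eq.
apply: (@roots_geq_poly_eq0 _ _ [seq i.+1%:R | i <- iota 0 (size (p - q))]).
- apply/allP => _ /mapP[i _ ->].
  by rewrite rootE hornerD hornerN pq ?subrr // pnatr_eq0.
- rewrite map_inj_uniq ?iota_uniq // => i j /eqP.
  by rewrite eqr_nat eqSS => /eqP.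
- by rewrite size_map size_iota.
Qed.

(** * Comparison with the symmetric functions of the eigenvalues *)

Section Split.
Variables (R : numFieldType) (n : nat) (A : 'M[R]_n) (s : n.-tuple R).
Hypothesis As : char_poly A = \prod_(x <- s) ('X - x%:P).

(** Vieta's formulas, since det (1 + t A) is the characteristic polynomial reversed, up to signs. *)
Lemma esigma_split k : esigma k A = mpoly.meval (tnth s) (mpoly.mesym n R k).
Proof.
pose e k := mpoly.meval (tnth s) (mpoly.mesym n R k).
suff E : \det (onePX A) = \poly_(i < n.+1) e i.
  (* Both sides are 0 for k > n. *)
  rewrite /esigma E coef_poly ltnS; case: leqP => // nk.
  by rewrite mpoly.mesym_geqnE // mpoly.meval0.
(* For t <> 0, det (1 + t A) = (- t)^n det (- 1/t - A). *)
apply: poly_eq_off0 => t t0; set u := - t^-1.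
have tu : - t * u = 1 by rewrite mulrNN divff.
have -> : (\det (onePX A)).[t] = (- t) ^+ n * (char_poly A).[u].
  rewrite -[LHS]/(horner_eval t _) -[_.[u]]/(horner_eval u _) -!det_map_mx.
  rewrite -detZ; congr (\det _); apply/matrixP => i j.
  rewrite !mxE /= /horner_eval !hornerE !hornerMn hornerX hornerC.
  by rewrite mulrBr mulrnAr tu mulNr opprK.
rewrite (@horner_coef_wide _ n.+1) ?size_char_poly //.
(* Vieta places the k-th symmetric function, with sign (-1)^k, in degree n - k; hence the reversal
   of the index. *)
rewrite horner_poly (reindex_inj rev_ord_inj) mulr_sumr /=.
apply: eq_bigr => k0 _; rewrite subSS As mpoly.mroots_coeff -/(e _).
have {1}-> : n = (k0 + (n - k0))%N by rewrite subnKC // -ltnS.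
have ab : (- t) ^+ (n - k0) * u ^+ (n - k0) = 1 by rewrite -exprMn tu expr1n.
have ss : (-1) ^+ k0 * (-1) ^+ k0 = 1 :> R by rewrite -exprMn mulrNN mulr1 expr1n.
rewrite exprD [(-t) ^+ k0]exprNn.
move: ab ss; move: ((- t) ^+ _) (u ^+ _) (t ^+ _) ((-1) ^+ _) => a b c d ab dd.
transitivity ((d * d) * (a * b) * (e k0 * c)); first by ring.
by rewrite ab dd !mul1r.
Qed.

End Split.

(** * A symmetric matrix times an inverse Gram matrix has real eigenvalues *)

Section Pencil.
Variables (R : rcfType) (n m : nat) (h : 'M[R]_n) (J : 'M[R]_(n, m)).
Hypothesis hT : h^T = h.
Hypothesis J_free : row_free J.

(** If w J J^T = 0, then w J has squared length 0, so w = 0. *)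
Lemma gram_unit : J *m J^T \in unitmx.
Proof.
rewrite -row_free_unit -kermx_eq0; apply/rowV0P => w /sub_kermxP.
rewrite mulmxA => wJJ.
suff wJ : w *m J = 0.
  by apply/eqP; rewrite -(mulmx_free_eq0 w J_free) wJ.
have : (w *m J *m (w *m J)^T) 0 0 = 0.
  by rewrite trmx_mul !mulmxA wJJ mul0mx mxE.
rewrite mxE => /eqP; rewrite psumr_eq0; last first.
  by move=> i _; rewrite [X in _ * X]mxE -expr2 sqr_ge0.
move=> /allP w0; apply/matrixP => i j; rewrite [RHS]mxE ord1.
have := w0 j (mem_index_enum _).
by rewrite [X in _ * X]mxE mulf_eq0 orbb => /eqP.
Qed.

Local Notation toC := (real_complex R).

(* If v h = z v g with g = J J^T, then z is the quotient of the real numbers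
   v h v^* and v g v^*, the latter being positive. *)
Lemma pencil_root_real z :
  root (map_poly toC (char_poly (h *m invmx (J *m J^T)))) z -> z \is Num.real.
Proof.
rewrite map_char_poly -eigenvalue_root_char => /eigenvalueP[v vz v0].
pose hc := map_mx toC h; pose Jc := map_mx toC J.
pose vc := map_mx Num.conj v.
have toC_conj x : Num.conj (toC x) = toC x.
  by apply/CrealP/complex_realP; exists x.
have vh : v *m hc = z *: (v *m Jc *m Jc^T).
  rewrite -mulmxA /Jc map_trmx -map_mxM scalemxAl -vz -mulmxA -map_mxM.
  by rewrite mulmxKV // gram_unit.
pose a := (v *m hc *m vc^T) 0 0.
pose b := (v *m Jc *m (vc *m Jc)^T) 0 0.
have ab : a = z * b.
  by rewrite /a /b vh -scalemxAl mxE trmx_mul mulmxA.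
(* As h is real and symmetric, [a] equals its conjugate. *)
have a_real : a \is Num.real.
  have aE : map_mx Num.conj (v *m hc *m vc^T) = (v *m hc *m vc^T)^T.
    rewrite !map_mxM !trmx_mul trmxK mulmxA; congr (_ *m _ *m _).
      apply/matrixP => i j; rewrite !mxE; apply: etrans (toC_conj _) _.
      by rewrite -[in LHS]hT mxE.
    by apply/matrixP => i j; rewrite !mxE; exact: conjCK.
  apply/CrealP; rewrite /a; transitivity ((map_mx Num.conj (v *m hc *m vc^T)) 0 0).
    by apply/esym; rewrite mxE.
  by rewrite aE mxE.
have vJ : v *m Jc != 0 by rewrite mulmx_free_eq0 // row_free_map.
(* [b] is the squared Hermitian norm of v J, nonzero because J keeps full row rank over the complex
   numbers. *)
have b_gt0 : 0 < b.
  have bE : b = \sum_j `|(v *m Jc) 0 j| ^+ 2.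
    rewrite /b mxE; apply: eq_bigr => j _; rewrite normCK mxE.
    congr (_ * _); rewrite !mxE rmorph_sum; apply: eq_bigr => i _.
    by rewrite rmorphM /= !mxE toC_conj.
  rewrite bE lt_def sumr_ge0 ?andbT => [|j _]; last exact: exprn_ge0.
  apply: contra vJ; rewrite psumr_eq0 => [/allP w0|j _]; last exact: exprn_ge0.
  apply/eqP/matrixP => i j; rewrite ord1 [RHS]mxE.
  have := w0 j (mem_index_enum _).
  by rewrite expf_eq0 /= normr_eq0 => /eqP.
have -> : z = a / b by rewrite ab mulfK // gt_eqF.
by rewrite realM // realV gtr0_real.
Qed.

(** Over the complex numbers the polynomial splits; its roots are real, so the factorization
    descends. *)
Lemma char_poly_pencil :
  exists s : n.-tuple R, char_poly (h *m invmx (J *m J^T)) =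
    \prod_(x <- s) ('X - x%:P).
Proof.
set A := _ *m _.
have [r rE] := closed_field_poly_normal (map_poly toC (char_poly A)).
have r_real z : z \in r -> z = toC (complex.Re z).
  move=> zr; rewrite RRe_real //; apply: pencil_root_real; rewrite -/A rE.
  rewrite rootE hornerZ horner_prod; apply/eqP.
  by rewrite (big_rem z) //= hornerXsubC subrr mul0r mulr0.
have E : char_poly A = \prod_(x <- map (@complex.Re R) r) ('X - x%:P).
  apply: (map_poly_inj toC).
  rewrite rE (monicP _) ?map_monic ?char_poly_monic // scale1r rmorph_prod big_map.
  apply: eq_big_seq => z /r_real zE.
  by rewrite /= map_polyXsubC {1}zE.
have sz : size (map (@complex.Re R) r) == n.
  have := size_char_poly A.
  by rewrite E size_prod_XsubC size_map => -[->].
by exists (Tuple sz).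
Qed.

End Pencil.

(** * Symmetry of second derivatives *)

Section Schwarz.
Variables (R : realType) (V : normedModType R).
Implicit Types (f : V -> R) (x u v : V) (h : R).

Lemma is_derive_line f x u (s : R) : derivable f (x + s *: u) u ->
  is_derive s 1 (fun s => f (x + s *: u)) ('D_u f (x + s *: u)).
Proof.
move=> df.
have E : (fun h => h^-1 *: ((f \o shift (x + s *: u)) (h *: u) - f (x + s *: u)))
  = (fun h => h^-1 *: (((fun s => f (x + s *: u)) \o shift s) (h *: 1)
       - f (x + s *: u))).
  apply/funext => h /=; congr (_ *: (f _ - _)).
  by rewrite [h *: 1]mulr1 scalerDl addrCA.
by apply: DeriveDef; rewrite ?/derivable ?/derive -E.
Qed.

Lemma mean_value_line f x u h : 0 < h ->
  (forall s, 0 <= s <= h -> derivable f (x + s *: u) u) ->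
  exists2 c, 0 <= c <= h & f (x + h *: u) - f x = h * 'D_u f (x + c *: u).
Proof.
move=> h0 df.
have [||c] := @MVT R (fun s => f (x + s *: u)) (fun s => 'D_u f (x + s *: u)) 0 h h0.
- move=> s; rewrite in_itv /= => /andP[/ltW s0 /ltW sh].
  by apply: is_derive_line; apply: df; rewrite s0.
- apply: derivable_within_continuous => s; rewrite in_itv /= => sh.
  by have [] := is_derive_line (df _ sh).
rewrite in_itv /= => /andP[/ltW c0 /ltW ch].
rewrite scale0r addr0 subr0 => ->.
by exists c; [rewrite c0|rewrite mulrC].
Qed.

(** The mean value theorem is applied along u to f(y + h v) - f(y), then along v to the derivative
    of f along u. *)
Lemma second_difference f x u v h : 0 < h ->
  (forall a b, 0 <= a <= h -> 0 <= b <= h ->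
    derivable f (x + a *: u + b *: v) u /\
    derivable ('D_u f) (x + a *: u + b *: v) v) ->
  exists a b, [/\ 0 <= a <= h, 0 <= b <= h &
    f (x + h *: u + h *: v) - f (x + h *: u) - f (x + h *: v) + f x
    = h * h * 'D_v ('D_u f) (x + a *: u + b *: v)].
Proof.
move=> h0 df; pose phi y := f (y + h *: v) - f y.
have hh : 0 <= h <= h by rewrite lexx ltW.
have dshift y : derivable f (y + h *: v) u ->
    is_derive y u (fun y => f (y + h *: v)) ('D_u f (y + h *: v)).
  move=> d.
  have E : (fun t => t^-1 *: ((f \o shift (y + h *: v)) (t *: u) - f (y + h *: v)))
    = (fun t => t^-1 *: (((fun y => f (y + h *: v)) \o shift y) (t *: u)
       - f (y + h *: v))).
    by apply/funext => t /=; rewrite addrA.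
  by apply: DeriveDef; rewrite ?/derivable ?/derive -E.
have dphi s : 0 <= s <= h -> is_derive (x + s *: u) u phi
    ('D_u f (x + s *: u + h *: v) - 'D_u f (x + s *: u)).
  move=> sh; have [d1 _] := df s h sh hh.
  have [|d2 _] := df s 0 sh; first by rewrite lexx ltW.
  rewrite scale0r addr0 in d2.
  exact: is_deriveB (dshift _ d1) (derivableP d2).
have [s sh|a ah] := @mean_value_line phi x u h h0.
  by have [] := dphi s sh.
have [_ ->] := dphi a ah.
have [s sh|b bh -> E] := @mean_value_line ('D_u f) (x + a *: u) v h h0.
  by have [] := df a s ah sh.
by exists a, b; split; rewrite // -mulrA -E /phi; ring.
Qed.

(* By the mean value theorem, both mixed derivatives at points arbitrarily close
   to x are equal to the same second difference quotient. *)
Lemma derive_comm f x u v :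
  (\forall y \near x, [/\ derivable f y u, derivable f y v,
    derivable ('D_u f) y v & derivable ('D_v f) y u]) ->
  {for x, continuous ('D_v ('D_u f))} -> {for x, continuous ('D_u ('D_v f))} ->
  'D_v ('D_u f) x = 'D_u ('D_v f) x.
Proof.
move=> fx cvu cuv; apply/eqP; rewrite -subr_eq0 -normr_le0.
apply/ler_addgt0Pr => e e0; rewrite add0r.
have e20 : 0 < e / 2 by rewrite divr_gt0.
have /nbhs_ballP[d d0 dP] : \forall y \near x, [/\
    [/\ derivable f y u, derivable f y v,
     derivable ('D_u f) y v & derivable ('D_v f) y u],
    `|'D_v ('D_u f) x - 'D_v ('D_u f) y| < e / 2 &
    `|'D_u ('D_v f) x - 'D_u ('D_v f) y| < e / 2].
  have near_lt (g : V -> R) : {for x, continuous g} ->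
      \forall y \near x, `|g x - g y| < e / 2.
    by move=> cg; exact: (cvgr_dist_lt _ _ cg).
  apply: filterS (filterI fx (filterI (near_lt _ cvu) (near_lt _ cuv))).
  by move=> y [fy [vuy uvy]]; exact: And3 fy vuy uvy.
(* Small enough to keep x + a u + b v within d / 2 of x; the summand 1 keeps the denominator
   positive even if u = v = 0. *)
pose h := d / (2 * (`|u| + `|v| + 1)).
have k0 : 0 < `|u| + `|v| + 1 by rewrite ltr_wpDl // addr_ge0.
have h0 : 0 < h by rewrite divr_gt0 // mulr_gt0.
have inball a b : 0 <= a <= h -> 0 <= b <= h -> ball x d (x + a *: u + b *: v).
  move=> /andP[a0 ah] /andP[b0 bh]; rewrite -ball_normE /=.
  rewrite -addrA opprD addNKr normrN.
  apply: (@le_lt_trans _ _ (h * (`|u| + `|v| + 1))); last first.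
    have -> : h * (`|u| + `|v| + 1) = d / 2 by rewrite /h; field; rewrite gt_eqF.
    by rewrite ltr_pdivrMr // ltr_pMr // ltr1n.
  apply: le_trans (ler_normD _ _) _; rewrite !normrZ (ger0_norm a0) (ger0_norm b0).
  have : a * `|u| <= h * `|u| by exact: ler_wpM2r.
  have : b * `|v| <= h * `|v| by exact: ler_wpM2r.
  by move: h0 => /ltW; lra.
have [a b ah bh|a [b [ah bh E1]]] := @second_difference f x u v h h0.
  by have [[]] := dP _ (inball a b ah bh).
have [a' b' ah' bh'|a' [b' [ah' bh' E2]]] := @second_difference f x v u h h0.
  by rewrite addrAC; have [[]] := dP _ (inball b' a' bh' ah').
have {E1 E2} E : 'D_v ('D_u f) (x + a *: u + b *: v) =
    'D_u ('D_v f) (x + b' *: u + a' *: v).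
  apply: (@mulfI _ (h * h)); first by rewrite mulf_neq0 // gt_eqF.
  rewrite -E1 [in RHS]addrAC -E2 [x + h *: v + _]addrAC; ring.
have [_ l1 _] := dP _ (inball a b ah bh).
have [_ _ l2] := dP _ (inball b' a' bh' ah').
rewrite E in l1; rewrite distrC in l2.
have l12 := lerD (ltW l1) (ltW l2); rewrite -splitr in l12.
apply: le_trans l12; apply: le_trans (ler_normD _ _).
by rewrite subrKA.
Qed.

End Schwarz.

Section Partials.
Variables (R : realType) (n : nat) (U : set 'rV[R]_n) (f : 'rV[R]_n -> R).
Hypotheses (Uo : open U) (fU : smooth_on U f).

Lemma smooth_on_partial i : smooth_on U (partial i f).
Proof. by move=> s x Ux; have := fU (rcons s i) Ux; rewrite foldr_rcons. Qed.

Lemma partial_comm i j x : U x ->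
  partial i (partial j f) x = partial j (partial i f) x.
Proof.
move=> Ux; apply: derive_comm.
- near=> y; have Uy : U y by near: y; exact: open_nbhs_nbhs.
  split; apply: diff_derivable; [exact: (fU [::])|exact: (fU [::])
    |exact: (fU [:: j])|exact: (fU [:: i])].
- by apply: differentiable_continuous; exact: (fU [:: i; j]).
- by apply: differentiable_continuous; exact: (fU [:: j; i]).
Unshelve. all: by end_near. Qed.

End Partials.

(** * Derivatives of matrix-valued functions *)

Section Matrix_derivative.
Variables (R : realType) (V : normedModType R) (x v : V).
Implicit Types (f g : V -> R).

Lemma is_derive_const (c : R) : is_derive x v (fun=> c) 0.
Proof. exact: is_derive_cst. Qed.

Lemma is_derive_add f g a b : is_derive x v f a -> is_derive x v g b ->
  is_derive x v (fun y => f y + g y) (a + b).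
Proof. exact: is_deriveD. Qed.

Lemma is_derive_mul f g a b : is_derive x v f a -> is_derive x v g b ->
  is_derive x v (fun y => f y * g y) (a * g x + f x * b).
Proof.
move=> df dg; apply: is_derive_eq (is_deriveM df dg) _.
by rewrite addrC mulrC.
Qed.

Lemma is_derive_sumr (I : Type) (r : seq I) (F : I -> V -> R) (F' : I -> R) :
  (forall i, is_derive x v (F i) (F' i)) ->
  is_derive x v (fun y => \sum_(i <- r) F i y) (\sum_(i <- r) F' i).
Proof.
apply: (der_sum (der := fun f a => is_derive x v f a)) => [|f g a b].
- exact: is_derive_const.
- exact: is_derive_add.
Qed.

Lemma is_derive_det n (M : V -> 'M[R]_n) (M' : 'M[R]_n) :
  (forall i j, is_derive x v (fun y => M y i j) (M' i j)) ->
  is_derive x v (fun y => \det (M y)) (\tr (M' *m \adj (M x))).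
Proof.
apply: (der_det (der := fun f a => is_derive x v f a)) => [|b|f g a b|f g a b].
- exact: is_derive_const.
- exact: is_derive_const.
- exact: is_derive_add.
- exact: is_derive_mul.
Qed.

(** A relation, so that existence and value of the derivative travel together. *)
Definition mder p q (M : V -> 'M[R]_(p, q)) (M' : 'M[R]_(p, q)) : Prop :=
  forall i j, is_derive x v (fun y => M y i j) (M' i j).

Lemma mder_unique p q (M : V -> 'M[R]_(p, q)) A B :
  mder M A -> mder M B -> A = B.
Proof.
move=> dA dB; apply/matrixP => i j.
by rewrite -(@derive_val _ _ _ _ _ _ _ (dA i j)) (@derive_val _ _ _ _ _ _ _ (dB i j)).
Qed.

Lemma mder_near p q (M N : V -> 'M[R]_(p, q)) A :
  (\forall y \near x, M y = N y) -> mder M A -> mder N A.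
Proof.
move=> MN dM i j; apply: near_eq_is_derive (dM i j).
by apply: filterS MN => y ->.
Qed.

Lemma mder_cst p q (A : 'M[R]_(p, q)) : mder (fun=> A) 0.
Proof. by move=> i j; rewrite mxE; exact: is_derive_const. Qed.

Lemma mderB p q (M N : V -> 'M[R]_(p, q)) A B :
  mder M A -> mder N B -> mder (fun y => M y - N y) (A - B).
Proof.
move=> dM dN i j; rewrite !mxE; under eq_fun do rewrite !mxE.
exact: is_deriveB (dM i j) (dN i j).
Qed.

Lemma mderM p q r (M : V -> 'M[R]_(p, q)) (N : V -> 'M[R]_(q, r)) A B :
  mder M A -> mder N B -> mder (fun y => M y *m N y) (A *m N x + M x *m B).
Proof.
move=> dM dN i j; rewrite !mxE -big_split /=; under eq_fun do rewrite mxE.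
by apply: is_derive_sumr => k; exact: is_derive_mul.
Qed.

Lemma mder_trmx p q (M : V -> 'M[R]_(p, q)) A :
  mder M A -> mder (fun y => (M y)^T) A^T.
Proof. by move=> dM i j; rewrite mxE; under eq_fun do rewrite mxE. Qed.

Lemma mder_scalar n f a :
  is_derive x v f a -> mder (fun y => (f y)%:M : 'M[R]_n) a%:M.
Proof.
move=> df i j; rewrite mxE; under eq_fun do rewrite mxE.
case: (i == j) => //=; rewrite ?mulr1n //; exact: is_derive_const.
Qed.

(** Differentiability comes from Cramer's formula near x; the value then follows by differentiating
    M M^-1 = 1. *)
Lemma mder_invmx n (M : V -> 'M[R]_n) A :
  (\forall y \near x, M y \in unitmx) -> mder M A ->
  mder (fun y => invmx (M y)) (- (invmx (M x) *m A *m invmx (M x))).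
Proof.
move=> uM dM; have ux : M x \in unitmx by exact: nbhs_singleton uM.
have [B dB] : exists B, mder (fun y => invmx (M y)) B.
  have dadj i j : exists a, is_derive x v (fun y => cofactor (M y) j i) a.
    have dM' k l : is_derive x v (fun y => row' j (col' i (M y)) k l)
        (row' j (col' i A) k l).
      by rewrite !mxE; under eq_fun do rewrite !mxE.
    have dc := is_derive_mul (is_derive_const ((-1) ^+ (j + i)))
      (is_derive_det dM').
    by eexists; exact: dc.
  have ddetV : exists a, is_derive x v (fun y => (\det (M y))^-1) a.
    have u0 : \det (M x) != 0 by rewrite -unitfE -unitmxE.
    have [ddet _] := is_derive_det dM.
    exists ('D_v (fun y => (\det (M y))^-1) x).
    by apply: derivableP; exact: (@derivableV _ _ (fun y => \det (M y)) _ _ u0 ddet).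
  have dd ij : exists a, is_derive x v (fun y => invmx (M y) ij.1 ij.2) a.
    have [a da] := dadj ij.1 ij.2; have [b db] := ddetV.
    eexists; apply: near_eq_is_derive (is_derive_mul db da).
    apply: filterS uM => y uy; by rewrite /invmx uy !mxE.
  have [B dB] := choice dd.
  by exists (\matrix_(i, j) B (i, j)) => i j; rewrite mxE; exact: dB (i, j).
have E : A *m invmx (M x) + M x *m B = 0.
  apply: mder_unique (mderM dM dB) _; apply: mder_near (mder_cst 1%:M).
  by apply: filterS uM => y uy; rewrite mulmxV.
suff -> : - (invmx (M x) *m A *m invmx (M x)) = B by [].
by apply/eqP; rewrite eq_sym -addr_eq0 -{1}(mulKmx ux B) -mulmxA -mulmxDr addrC E mulmx0.
Qed.

(** * Derivatives of symmetric functions and Newton transformations *)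

Section Newton.
Variables (n : nat) (M : V -> 'M[R]_n) (M' : 'M[R]_n).
Hypothesis dM : mder M M'.

(** Jacobi's formula once more, for the derivation acting on polynomials coefficient by coefficient;
    the factor X in the derivative of 1 + X M shifts k + 1 to k. *)
Lemma is_derive_esigma k :
  is_derive x v (fun y => esigma k.+1 (M y)) (\tr (M' *m newton k (M x))).
Proof.
pose der (p : V -> {poly R}) (p' : {poly R}) :=
  forall k, is_derive x v (fun y => (p y)`_k) p'`_k.
have : der (fun y => \det (onePX (M y)))
    (\tr (('X *: map_mx polyC M') *m \adj (onePX (M x)))).
  apply: der_det.
  - by move=> l; under eq_fun do rewrite coef0; rewrite coef0; exact: is_derive_const.
  - by move=> b l; rewrite coef0; exact: is_derive_const.
  - move=> f g a b df dg l; under eq_fun do rewrite coefD; rewrite coefD.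
    exact: is_derive_add.
  - move=> f g a b df dg l; under eq_fun do rewrite coefM.
    rewrite coefD !coefM -big_split /=.
    by apply: is_derive_sumr => i; exact: is_derive_mul.
  - move=> i j l; under eq_fun do rewrite !mxE coefD coefXM coefC.
    rewrite !mxE coefXM coefC -[X in is_derive _ _ _ X]add0r.
    case: l => [|[|l]] /=.
    + exact: (is_derive_add (is_derive_const _) (is_derive_const _)).
    + exact: (is_derive_add (is_derive_const _) (dM i j)).
    + exact: (is_derive_add (is_derive_const _) (is_derive_const _)).
move/(_ k.+1); congr is_derive; rewrite /mxtrace coef_sum; apply: eq_bigr => i _.
rewrite !mxE coef_sum; apply: eq_bigr => j _.
by rewrite !mxE -mulrA coefXM /= coefCM.
Qed.

Lemma is_derive_esigma_inf mu k :
  is_derive x v (fun y => esigma_inf mu k.+1 (M y))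
    (\tr (M' *m newton_inf mu k (M x))).
Proof.
rewrite /esigma_inf; under eq_fun do rewrite big_ord_recr /= subnn esigma0.
rewrite -[X in is_derive _ _ _ X]addr0; apply: (is_derive_add _ (is_derive_const _)).
rewrite mulmx_sumr raddf_sum; apply: is_derive_sumr => j /=.
rewrite subSn ?leq_ord //.
apply: is_derive_eq (is_derive_mul (is_derive_const _) (is_derive_esigma _)) _.
by rewrite mul0r add0r -scalemxAr mxtraceZ.
Qed.

Lemma mder_newton_infS mu k N :
  mder (fun y => newton_inf mu k (M y)) N ->
  mder (fun y => newton_inf mu k.+1 (M y))
   ((\tr (M' *m newton_inf mu k (M x)))%:M
    - (M' *m newton_inf mu k (M x) + M x *m N)).
Proof.
move=> dN; under eq_fun do rewrite newton_infS.
apply: mderB; last exact: mderM.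
by apply: mder_scalar; exact: is_derive_esigma_inf.
Qed.

Lemma newton_inf_derivable mu k : exists N, mder (fun y => newton_inf mu k (M y)) N.
Proof.
elim: k => [|k [N dN]]; last by eexists; exact: mder_newton_infS dN.
by exists 0; under eq_fun do rewrite newton_inf0; exact: mder_cst.
Qed.

End Newton.

End Matrix_derivative.

(** * Hypersurfaces in a chart *)

Section Split_symmetric_functions.
Variables (R : realType) (n : nat) (A : 'M[R]_n).
Hypothesis As : exists s : n.-tuple R, char_poly A = \prod_(x <- s) ('X - x%:P).

Lemma sigmaE k : sigma k A = esigma k A.
Proof.
have [s sE] := As; rewrite /sigma (@esigma_split _ _ _ (eigenvals A)) //.
(* A splitting exists, so the default of [xget] is not taken. *)
exact: (@xgetPex _ (nseq_tuple n 0) [set s : n.-tuple R | _] As).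
Qed.

Lemma sigma_infE mu k : sigma_inf mu k A = esigma_inf mu k A.
Proof. by apply: eq_bigr => j _; rewrite sigmaE. Qed.

Lemma T_infE mu k : T_inf mu k A = newton_inf mu k A.
Proof. by rewrite newton_infE; apply: eq_bigr => j _; rewrite sigma_infE. Qed.

End Split_symmetric_functions.

Lemma mulmx_trmx_entry (R : comNzRingType) p q r
    (A : 'M[R]_(p, q)) (B : 'M[R]_(r, q)) i j :
  (A *m B^T) i j = (B *m A^T) j i.
Proof. by rewrite -[B *m _]trmxK [RHS]mxE trmx_mul trmxK. Qed.

(** M' - P M + M P is a derivation in M, and P commutes with scalars: this is its product rule on b
    - A t, with a the derivative of b. *)
Lemma commutator_derivation (R : comNzRingType) n (P A A' t t' : 'M[R]_n) (a b : R) :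
  a%:M - (A' *m t + A *m t') - P *m (b%:M - A *m t) + (b%:M - A *m t) *m P =
  a%:M - (A' - P *m A + A *m P) *m t - A *m (t' - P *m t + t *m P).
Proof.
rewrite !(mulmxDr, mulmxDl, mulmxBl, mulmxBr, mulNmx, mulmxN) scalar_mxC !mulmxA.
move: (a%:M) (_%:M *m _) (A' *m t) (A *m t') (P *m A *m t)
    (A *m t *m P) (A *m P *m t) => c1 c2 m1 m2 m3 m4 m5.
by apply/matrixP => i j; rewrite !mxE; ring.
Qed.

(** By cyclicity of the trace, the commutator of A and P is orthogonal to everything that commutes
    with A. *)
Lemma mxtrace_commutator (R : comNzRingType) n (P A A' t : 'M[R]_n) :
  A *m t = t *m A -> \tr ((A' - P *m A + A *m P) *m t) = \tr (A' *m t).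
Proof.
move=> At; rewrite mulmxDl mulmxBl raddfD raddfB /=.
by rewrite -[A *m P *m t]mulmxA [\tr (A *m _)]mxtrace_mulC -!mulmxA At subrK.
Qed.

(** If G is parallel, that is G' = - (P G + G Q), raising an index with G commutes with covariant
    differentiation. *)
Lemma metric_derivation (R : comNzRingType) n (P Q G t t' : 'M[R]_n) :
  - (P *m G + G *m Q) *m t + G *m t' + P *m (G *m t) + G *m t *m Q =
  G *m (t' - Q *m t + t *m Q).
Proof.
rewrite !(mulmxDr, mulmxDl, mulmxN, mulNmx) !mulmxA.
move: (P *m G *m t) (G *m t') (G *m Q *m t) (G *m t *m Q) => m1 m2 m3 m4.
by apply/matrixP => k l; rewrite !mxE; ring.
Qed.

(** * The equations of Gauss and Codazzi in a chart *)

Section Local_hypersurface.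
Variables (R : realType) (n : nat) (X N : 'rV[R]_n -> 'rV[R]_n.+1).
Variable U : set 'rV[R]_n.
Hypothesis Uo : open U.
Hypothesis X_smooth : forall a, smooth_on U (fun x => X x 0 a).
Hypothesis N_smooth : forall a, smooth_on U (fun x => N x 0 a).
Hypothesis X_free : forall x, U x -> row_free (\matrix_(i < n) vpartial i X x).
Hypothesis N_unit : forall x, U x -> dot (N x) (N x) = 1.
Hypothesis N_orth : forall x, U x -> forall i, dot (vpartial i X x) (N x) = 0.

Definition jac x : 'M[R]_(n, n.+1) := \matrix_(i < n) vpartial i X x.

Definition jac' l x : 'M[R]_(n, n.+1) :=
  \matrix_(i, a) partial l (partial i (fun y => X y 0 a)) x.

Definition jac'' j k x : 'M[R]_(n, n.+1) :=
  \matrix_(i, a) partial j (partial k (partial i (fun y => X y 0 a))) x.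

Local Notation g := (metric X).
Local Notation G := (metric_inv X).

Definition Gam l x : 'M[R]_n := \matrix_(k, i) christoffel X k l i x.

(* The column (h_{ki})_i. *)
Definition hcol k x : 'cV[R]_n := jac' k x *m (N x)^T.

Lemma nbhs_U x : U x -> nbhs x U.
Proof. by move=> Ux; exact: open_nbhs_nbhs. Qed.

Lemma smooth_is_derive (f : 'rV[R]_n -> R) l x : smooth_on U f -> U x ->
  is_derive x 'e_l f (partial l f x).
Proof. by move=> fU Ux; apply/derivableP/diff_derivable; exact: (fU [::]). Qed.

Lemma metricE x : g x = jac x *m (jac x)^T.
Proof.
by apply/matrixP => i j; rewrite mxE /dot !mxE; apply: eq_bigr => a _; rewrite !mxE.
Qed.

Lemma metric_unit x : U x -> g x \in unitmx.
Proof. by move=> Ux; rewrite metricE; exact: gram_unit (X_free Ux). Qed.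

Lemma metric_trmx x : (g x)^T = g x.
Proof. by rewrite metricE trmx_mul trmxK. Qed.

Lemma metric_inv_trmx x : (G x)^T = G x.
Proof. by rewrite /metric_inv trmx_inv metric_trmx. Qed.

Lemma normal_sqr x : U x -> N x *m (N x)^T = 1%:M.
Proof.
move=> Ux; apply/matrixP => i j; rewrite !ord1 -[LHS]/(dot _ _) N_unit //.
by rewrite mxE.
Qed.

Lemma jac_normal x : U x -> jac x *m (N x)^T = 0.
Proof.
move=> Ux; apply/matrixP => i j; rewrite ord1 [RHS]mxE -[RHS](N_orth Ux i) /dot !mxE.
by apply: eq_bigr => a _; rewrite !mxE.
Qed.

Lemma mder_jac x l : U x -> mder x 'e_l jac (jac' l x).
Proof.
move=> Ux i a; rewrite !mxE; under eq_fun do rewrite !mxE.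
by apply: smooth_is_derive => //; exact: smooth_on_partial.
Qed.

Lemma mder_jac' x j k : U x -> mder x 'e_j (jac' k) (jac'' j k x).
Proof.
move=> Ux i a; rewrite !mxE; under eq_fun do rewrite !mxE.
by apply: smooth_is_derive => //; do 2!apply: smooth_on_partial.
Qed.

Lemma jac'_sym x i k a : U x -> jac' k x i a = jac' i x k a.
Proof.
move=> Ux; rewrite [LHS]mxE [RHS]mxE.
exact: (@partial_comm _ _ U _ Uo (X_smooth a) k i x Ux).
Qed.

Lemma jac''_sym x j k : U x -> jac'' j k x = jac'' k j x.
Proof.
move=> Ux; apply/matrixP => i a; rewrite [LHS]mxE [RHS]mxE.
exact: (@partial_comm _ _ U _ Uo (smooth_on_partial (X_smooth a) i) j k x Ux).
Qed.

Lemma mder_metric x l : U x -> 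
  mder x 'e_l g (jac' l x *m (jac x)^T + jac x *m (jac' l x)^T).
Proof.
move=> Ux; have dJ := mder_jac l Ux.
rewrite (_ : g = fun y => jac y *m (jac y)^T); last by apply/funext => y; rewrite metricE.
by apply: mderM => //; exact: mder_trmx.
Qed.

(** With K_lim the product of d_l d_i X and d_m X, each derivative of the metric is a sum of two
    such terms; symmetry of K in l and i collapses the Christoffel combination to 2 K_lim. *)
Lemma GamE x l : U x -> Gam l x = G x *m (jac x *m (jac' l x)^T).
Proof.
move=> Ux; apply/matrixP => k i; rewrite [LHS]mxE [RHS]mxE /christoffel.
rewrite mulr_sumr; apply: eq_bigr => m _; rewrite mulrCA; congr (_ * _).
pose K l i m := (jac' l x *m (jac x)^T) i m.
have dg l' i' m' : partial l' (fun y => g y i' m') x = K l' i' m' + K l' m' i'.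
  rewrite /partial (@derive_val _ _ _ _ _ _ _ (mder_metric l' Ux i' m')).
  by rewrite [LHS]mxE; congr (_ + _); exact: mulmx_trmx_entry.
have Ksym i' j' m' : K i' j' m' = K j' i' m'.
  rewrite [LHS]mxE [RHS]mxE; apply: eq_bigr => a _.
  by congr (_ * _); exact: (jac'_sym j' i' a Ux).
have -> : (jac x *m (jac' l x)^T) m i = K l i m by exact: mulmx_trmx_entry.
rewrite (dg l i m) (dg i l m) (dg m l i); clearbody K.
rewrite (Ksym i l) (Ksym m l) (Ksym m i).
by field.
Qed.

Lemma Gam_sym x k i l : U x -> Gam l x k i = Gam i x k l.
Proof.
move=> Ux; rewrite !GamE // [LHS]mxE [RHS]mxE; apply: eq_bigr => m _; congr (_ * _).
rewrite [LHS]mxE [RHS]mxE; apply: eq_bigr => a _; congr (_ * _).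
by rewrite [LHS]mxE [RHS]mxE; exact: (jac'_sym i l a Ux).
Qed.

(** The inverse metric is parallel: insert [GamE] into the derivative of an inverse. *)
Lemma mder_metric_inv x l : U x ->
  mder x 'e_l G (- (Gam l x *m G x + G x *m (Gam l x)^T)).
Proof.
move=> Ux; have -> : - (Gam l x *m G x + G x *m (Gam l x)^T) =
  - (invmx (g x) *m (jac' l x *m (jac x)^T + jac x *m (jac' l x)^T) *m invmx (g x)).
  rewrite GamE // !trmx_mul metric_inv_trmx trmxK -/(G x).
  by rewrite mulmxDr mulmxDl addrC !mulmxA.
apply: mder_invmx (mder_metric l Ux).
by apply: filterS (nbhs_U Ux) => y; exact: metric_unit.
Qed.

(** The tangent vectors and the normal form a basis of the ambient space. *)
Lemma frame_inj x m (E : 'M[R]_(m, n.+1)) : U x ->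
  E *m (jac x)^T = 0 -> E *m (N x)^T = 0 -> E = 0.
Proof.
move=> Ux EJ EN; pose P := col_mx (jac x) (N x).
have fP : row_free P.
  rewrite -kermx_eq0; apply/rowV0P => w /sub_kermxP.
  rewrite -[w]hsubmxK mul_row_col => w0.
  have w2 : rsubmx w = 0.
    have := congr1 (mulmx^~ (N x)^T) w0.
    by rewrite mulmxDl -!mulmxA jac_normal // normal_sqr // mulmx0 add0r mulmx1 mul0mx.
  rewrite w2 mul0mx addr0 in w0.
  have w1 : lsubmx w = 0.
    by apply/eqP; rewrite -(mulmx_free_eq0 _ (X_free Ux)) -/(jac x) w0.
  by rewrite w1 w2 row_mx0.
have fPT : row_free P^T by rewrite /row_free mxrank_tr (eqP fP) addn1.
apply/eqP; rewrite -(mulmx_free_eq0 E fPT).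
by rewrite tr_col_mx mul_mx_row EJ EN row_mx0.
Qed.

(** Both sides have the same products with the tangent vectors, by [GamE], and with the normal. *)
Lemma gauss x l : U x ->
  jac' l x = (Gam l x)^T *m jac x + hcol l x *m N x.
Proof.
move=> Ux; apply/subr0_eq/(frame_inj Ux); rewrite mulmxBl mulmxDl -!mulmxA.
  rewrite -metricE GamE // !trmx_mul trmxK metric_inv_trmx -!mulmxA mulVmx ?metric_unit //.
  have -> : N x *m (jac x)^T = 0.
    by rewrite -[LHS]trmxK trmx_mul trmxK jac_normal // trmx0.
  by rewrite mulmx1 !mulmx0 addr0 subrr.
by rewrite jac_normal // normal_sqr // mulmx0 add0r mulmx1 subrr.
Qed.

(** The derivative of N is tangent as N has length 1, and its products with the tangent vectors are
    -h. The third derivatives of X are kept explicit since their symmetry in j and k yields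
    Codazzi. *)
Lemma mder_hcol x j k : U x ->
  mder x 'e_j (hcol k) (jac'' j k x *m (N x)^T - (Gam k x)^T *m hcol j x).
Proof.
move=> Ux; pose N' := \row_a partial j (fun y => N y 0 a) x.
have dN : mder x 'e_j N N'.
  move=> i a; rewrite mxE ord1; exact: (smooth_is_derive j (N_smooth a) Ux).
have NN' : N x *m N'^T = 0.
  have : N' *m (N x)^T + N x *m N'^T = 0.
    apply: mder_unique (mderM dN (mder_trmx dN)) _.
    apply: mder_near (mder_cst _ _ 1%:M).
    by apply: filterS (nbhs_U Ux) => y Uy; rewrite normal_sqr.
  move=> /matrixP E; apply/matrixP => a b; rewrite !ord1.
  have := E 0 0; rewrite [LHS]mxE mulmx_trmx_entry -mulr2n [RHS]mxE => /eqP.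
  by rewrite mulrn_eq0 /= => /eqP ->; rewrite mxE.
have JN' : jac x *m N'^T = - hcol j x.
  apply/eqP; rewrite -addr_eq0 addrC /hcol; apply/eqP.
  apply: mder_unique (mderM (mder_jac j Ux) (mder_trmx dN)) _.
  apply: mder_near (mder_cst _ _ 0).
  by apply: filterS (nbhs_U Ux) => y Uy; rewrite jac_normal.
suff <- : jac'' j k x *m (N x)^T + jac' k x *m N'^T =
    jac'' j k x *m (N x)^T - (Gam k x)^T *m hcol j x.
  exact: mderM (mder_jac' j k Ux) (mder_trmx dN).
congr (_ + _); rewrite (gauss k Ux) mulmxDl -!mulmxA NN' JN' mulmxN.
by rewrite !mulmx0 addr0.
Qed.

Definition hmat x : 'M[R]_n := \matrix_(i, k) second_form X N i k x.

Lemma hmatE x i k : hmat x i k = hcol i x k 0.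
Proof.
rewrite mxE /second_form /dot /hcol [LHS]mxE [RHS]mxE; apply: eq_bigr => a _.
congr (_ * _); rewrite mxE [RHS]mxE; congr partial.
by apply/funext => y; rewrite mxE.
Qed.

Lemma hmat_trmx x : U x -> (hmat x)^T = hmat x.
Proof.
move=> Ux; apply/matrixP => i k; rewrite [LHS]mxE !hmatE /hcol [LHS]mxE [RHS]mxE.
by apply: eq_bigr => a _; congr (_ * _); exact: (jac'_sym i k a Ux).
Qed.

Definition shape x : 'M[R]_n := hmat x *m G x.

Lemma shape_opE x : shape_op X N x = shape x.
Proof.
apply/matrixP => i j; rewrite [LHS]mxE [RHS]mxE; apply: eq_bigr => k _.
by rewrite -{1}metric_inv_trmx [(_^T) _ _]mxE mulrC [hmat _ _ _]mxE.
Qed.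

Lemma shape_split x : U x ->
  exists s : n.-tuple R, char_poly (shape x) = \prod_(a <- s) ('X - a%:P).
Proof.
move=> Ux; rewrite /shape /metric_inv metricE.
by apply: char_poly_pencil; [exact: hmat_trmx|exact: X_free].
Qed.

Definition hmat' j x : 'M[R]_n :=
  \matrix_(k, i) (jac'' j k x *m (N x)^T - (Gam k x)^T *m hcol j x) i 0.

Lemma mder_hmat x j : U x -> mder x 'e_j hmat (hmat' j x).
Proof.
move=> Ux k i; under eq_fun do rewrite hmatE; rewrite mxE.
exact: mder_hcol.
Qed.

(* Covariant derivative along e_j of an endomorphism field with value M and
   partial derivative M' at x, with the lower index as row index. *)
Definition nab j x (M M' : 'M[R]_n) : 'M[R]_n :=
  M' - (Gam j x)^T *m M + M *m (Gam j x)^T.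

Definition shape' j x : 'M[R]_n :=
  hmat' j x *m G x - hmat x *m (Gam j x *m G x + G x *m (Gam j x)^T).

Lemma mder_shape x j : U x -> mder x 'e_j shape (shape' j x).
Proof.
move=> Ux; rewrite /shape' -mulmxN.
exact: mderM (mder_hmat j Ux) (mder_metric_inv j Ux).
Qed.

(** The flat connection enters only through the commuting third derivatives of X; the Christoffel
    terms are exchanged or fixed when j and k are swapped. *)
Lemma codazzi x j k m : U x ->
  nab j x (shape x) (shape' j x) k m = nab k x (shape x) (shape' k x) j m.
Proof.
move=> Ux.
(* Since G is parallel, it factors out and leaves the covariant derivative of h. *)
have nabE l : nab l x (shape x) (shape' l x) =
    (hmat' l x - hmat x *m Gam l x - (Gam l x)^T *m hmat x) *m G x.
  rewrite /nab /shape' /shape !mulmxDr !mulmxBl !mulmxA opprD !addrA.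
  by rewrite [LHS]addrAC subrK.
rewrite !nabE [LHS]mxE [RHS]mxE; apply: eq_bigr => i _; congr (_ * _).
have HG a b : (hmat x *m Gam a x) b i = ((Gam a x)^T *m hcol b x) i 0.
  rewrite [LHS]mxE [RHS]mxE; apply: eq_bigr => c _.
  by rewrite hmatE [(_^T) _ _]mxE mulrC.
have GH : ((Gam j x)^T *m hmat x) k i = ((Gam k x)^T *m hmat x) j i.
  rewrite [LHS]mxE [RHS]mxE; apply: eq_bigr => c _; congr (_ * _).
  by rewrite [LHS]mxE [RHS]mxE; exact: Gam_sym.
pose q a b := (jac'' a b x *m (N x)^T) i 0.
have q_sym : q j k = q k j.
  exact: (congr1 (fun M => (M *m (N x)^T) i 0) (jac''_sym j k Ux)).
(* Swapping j and k interchanges [p j k] and [p k j], which occur with the same sign. *)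
pose p a b := ((Gam b x)^T *m hcol a x) i 0.
have entry a b : (hmat' a x - hmat x *m Gam a x - (Gam a x)^T *m hmat x) b i =
    q a b - p a b - p b a - ((Gam a x)^T *m hmat x) b i.
  have sub r s (A B : 'M[R]_(r, s)) c d : (A - B) c d = A c d - B c d.
    by rewrite !mxE.
  by rewrite !sub HG [hmat' _ _ _ _]mxE sub.
rewrite (entry j k) (entry k j) GH q_sym.
by clearbody q p; congr (_ - _); rewrite addrAC.
Qed.

(** * Newton transformations are divergence-free; the two differential expressions *)

Variable mu : R.

Local Notation T k x := (newton_inf mu k (shape x)).

(* In the divergence of T_{k+1} = sigma_{k+1} - A T_k, Codazzi turns the term
   with the derivative of A into tr (T_k nabla_i A), which is the i-th derivative
   of sigma_{k+1}. *)
Lemma newton_div_free x k (T' : 'I_n -> 'M[R]_n) i : U x ->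
  (forall j, mder x 'e_j (fun y => T k y) (T' j)) ->
  \sum_j nab j x (T k x) (T' j) i j = 0.
Proof.
move=> Ux; elim: k T' i => [|k IH] T' i dT.
  apply: big1 => j _; have -> : T' j = 0.
    apply: mder_unique (dT j) _; apply: mder_near (mder_cst _ _ 1%:M).
    by apply: filterS (nbhs_U Ux) => y _; rewrite newton_inf0.
  by rewrite /nab newton_inf0 mulmx1 mul1mx sub0r addNr mxE.
have [S' dS] := choice (fun j => newton_inf_derivable (mder_shape j Ux) mu k).
have T'E j : T' j = (\tr (shape' j x *m T k x))%:M
    - (shape' j x *m T k x + shape x *m S' j).
  apply: mder_unique (dT j) _.
  refine (mder_newton_infS (mder_shape j Ux) (dS j)).
pose A := shape x; pose tk := T k x.
pose nA j := nab j x A (shape' j x).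
have nabE j : nab j x (T k.+1 x) (T' j) =
    (\tr (shape' j x *m tk))%:M - nA j *m tk - A *m nab j x tk (S' j).
  by rewrite T'E newton_infS; exact: commutator_derivation.
have nA_trace : \tr (nA i *m tk) = \tr (shape' i x *m tk).
  by apply: mxtrace_commutator; exact: newton_inf_comm.
have -> : \sum_j nab j x (T k.+1 x) (T' j) i j =
    \tr (shape' i x *m tk) - \sum_j (nA j *m tk) i j
    - \sum_j (A *m nab j x tk (S' j)) i j.
  rewrite [X in X - _ - _](_ : _ = \sum_j (\tr (shape' j x *m tk))%:M i j).
    rewrite -!sumrB; apply: eq_bigr => j _; rewrite nabE.
    by move: (_%:M) (nA j *m tk) (A *m _) => c1 c2 c3; rewrite !mxE.
  rewrite (bigD1 i) //= big1 => [|j ji]; rewrite [_%:M _ _]mxE.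
    by rewrite eqxx addr0.
  by rewrite eq_sym (negPf ji).
have -> : \sum_j (nA j *m tk) i j = \tr (shape' i x *m tk).
  rewrite -nA_trace /mxtrace.
  under eq_bigr do rewrite mxE.
  under [RHS]eq_bigr do rewrite mxE.
  apply: eq_bigr => j _; apply: eq_bigr => m _; congr (_ * _).
  exact: codazzi.
rewrite subrr sub0r; apply/eqP; rewrite oppr_eq0; apply/eqP.
(* A does not depend on j and leaves the sum, so the divergence of T_k remains, which is 0 by
   induction. *)
under eq_bigr do rewrite mxE.
rewrite exchange_big big1 //= => m _.
by rewrite -mulr_sumr (IH S' m dS) mulr0.
Qed.

Lemma T_upE r i j y : U y -> T_up X N mu r i j y = (G y *m T r y) i j.
Proof.
move=> Uy; rewrite [RHS]mxE; apply: eq_bigr => k _.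
by rewrite shape_opE T_infE //; exact: shape_split.
Qed.

Local Notation Xc a := (fun y => X y 0 a).

Lemma jacE y i a : jac y i a = partial i (Xc a) y.
Proof. by rewrite !mxE. Qed.

Lemma hess_jac a i j x : U x ->
  hess X (Xc a) i j x = jac' j x i a - \sum_k Gam j x k i * jac x k a.
Proof.
move=> Ux; rewrite /hess [jac' _ _ _ _]mxE; congr (_ - _).
apply: eq_bigr => k _.
by rewrite jacE (Gam_sym k i j Ux) [Gam _ _ _ _]mxE.
Qed.

Lemma hessE a i j x : U x -> hess X (Xc a) i j x = hmat x j i * N x 0 a.
Proof.
move=> Ux; rewrite hess_jac // (gauss j Ux) [X in X - _ = _]mxE.
rewrite [X in X + _ - _ = _]mxE [X in _ + X - _ = _]mxE big_ord1 -hmatE.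
apply/eqP; rewrite subr_eq addrC; apply/eqP; congr (_ + _).
by apply: eq_bigr => k _; rewrite [(_^T) _ _]mxE.
Qed.

(** By Gauss the Hessian is h times the component of N; cyclicity turns the contraction with G T
    into tr (h G T). *)
Lemma T_hessE r a x : U x ->
  T_hess X N mu r (Xc a) x = \tr (shape x *m T r x) * N x 0 a.
Proof.
move=> Ux; rewrite /shape -mulmxA mxtrace_mulC /mxtrace mulr_suml.
apply: eq_bigr => i _; rewrite [X in X * _]mxE mulr_suml; apply: eq_bigr => j _.
by rewrite T_upE // hessE // mulrA.
Qed.

(** Product rule: the divergence is the Hessian contraction plus a term with the divergence of T,
    which vanishes. *)
Lemma T_divE r a x : U x ->
  T_div X N mu r (Xc a) x = T_hess X N mu r (Xc a) x.
Proof.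
move=> Ux.
have [T' dT] := choice (fun j => newton_inf_derivable (mder_shape j Ux) mu r).
pose S := G x *m T r x.
pose S' j := - (Gam j x *m G x + G x *m (Gam j x)^T) *m T r x + G x *m T' j.
have dS j : mder x 'e_j (fun y => G y *m T r y) (S' j).
  exact: mderM (mder_metric_inv j Ux) (dT j).
(* The left side is the covariant derivative of the twice contravariant tensor S = G T. *)
have S'E j : S' j + Gam j x *m S + S *m (Gam j x)^T = G x *m nab j x (T r x) (T' j).
  exact: metric_derivation.
have dV k j : partial j (fun y => \sum_i T_up X N mu r i k y * partial i (Xc a) y) x
    = \sum_i (S' j i k * jac x i a + S i k * jac' j x i a).
  have dV : is_derive x 'e_j (fun y => \sum_i T_up X N mu r i k y * partial i (Xc a) y)
      (\sum_i (S' j i k * jac x i a + S i k * jac' j x i a)).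
    apply: (@near_eq_is_derive _ _ _
        (fun y => \sum_i (G y *m T r y) i k * jac y i a)).
      apply: filterS (nbhs_U Ux) => y Uy; apply: eq_bigr => i _.
      by rewrite T_upE // jacE.
    apply: is_derive_sumr => i; exact: is_derive_mul (dS j i k) (mder_jac j Ux i a).
  exact: (@derive_val _ _ _ _ _ _ _ dV).
have cov j : cov_vec X (fun k y => \sum_i T_up X N mu r i k y * partial i (Xc a) y) j j x
    = \sum_i (G x *m nab j x (T r x) (T' j)) i j * jac x i a
      + \sum_i S i j * hess X (Xc a) i j x.
  rewrite /cov_vec dV.
  have -> : \sum_k christoffel X j j k x * (\sum_i T_up X N mu r i k x * partial i (Xc a) x)
      = \sum_i (S *m (Gam j x)^T) i j * jac x i a.
    under eq_bigr do rewrite mulr_sumr; rewrite exchange_big; apply: eq_bigr => i _.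
    rewrite [(_ *m _) i j]mxE mulr_suml; apply: eq_bigr => k _.
    rewrite T_upE // -jacE -/S [(_^T) _ _]mxE [Gam _ _ _ _]mxE.
    by rewrite mulrA [christoffel _ _ _ _ _ * _]mulrC.
  under [X in _ = _ + X]eq_bigr do rewrite hess_jac // mulrBr.
  (* Renaming indices shows that the Christoffel term of the Hessian is the term Gam S of the
     covariant derivative of S. *)
  have F : \sum_i S i j * (\sum_k Gam j x k i * jac x k a) =
      \sum_i (Gam j x *m S) i j * jac x i a.
    under eq_bigr do rewrite mulr_sumr; rewrite exchange_big; apply: eq_bigr => i _.
    rewrite [(_ *m _) i j]mxE mulr_suml; apply: eq_bigr => k _.
    by rewrite mulrCA mulrA.
  rewrite sumrB F -sumrB -!big_split; apply: eq_bigr => i _ /=.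
  have D p q (A B : 'M[R]_(p, q)) c d : (A + B) c d = A c d + B c d by rewrite mxE.
  rewrite -S'E !D; move: (S' j i j) (S i j) (jac x i a) (jac' j x i a).
  by move: ((Gam j x *m S) i j) ((S *m _) i j) => *; ring.
rewrite /T_div; under eq_bigr do rewrite cov.
rewrite big_split /= [X in X + _](_ : _ = 0) ?add0r.
  rewrite /T_hess [RHS]exchange_big; apply: eq_bigr => j _; apply: eq_bigr => i _.
  by rewrite T_upE.
(* The gradient component and then G leave the sum over j, leaving the divergence of T. *)
rewrite exchange_big big1 //= => i _; rewrite -mulr_suml.
suff -> : \sum_j (G x *m nab j x (T r x) (T' j)) i j = 0 by rewrite mul0r.
under eq_bigr do rewrite mxE.
rewrite exchange_big big1 //= => m _.
by rewrite -mulr_sumr (newton_div_free m Ux dT) mulr0.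
Qed.

End Local_hypersurface.

(** * From charts to the hypersurface *)

Theorem proposition10 (R : realType) (n : nat) (mu : R) (r : nat)
    (M : hypersurface R n) :
  (sigma_inf_minimal mu r M <->
     forall a : 'I_n.+1, position_hess_eq mu r M a) /\
  (sigma_inf_minimal mu r M <->
     forall a : 'I_n.+1, position_div_eq mu r M a).
Proof.
pose X c := in_chart (@position R n M) c.
pose N c := in_chart (@unit_normal R n M) c.
pose S c x := r.+1%:R * sigma_inf mu r.+1 (shape_op (X c) (N c) x)
  - mu * sigma_inf mu r (shape_op (X c) (N c) x).
have N_unit c x : dot (N c x) (N c x) = 1 by exact: normal_unit.
have hess_div c x a : atlas c -> chart_img c x ->
    T_hess (X c) (N c) mu r (fun y => X c y 0 a) x = S c x * N c x 0 a /\
    T_div (X c) (N c) mu r (fun y => X c y 0 a) x = S c x * N c x 0 a.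
  move=> cA cx.
  have Uo : open (chart_img c) by exact: chart_img_open.
  have Xs := position_smooth cA; have Ns := normal_smooth cA.
  have Xi := position_immersion cA; have No := normal_orth cA.
  have Nu y (_ : chart_img c y) := N_unit c y.
  have SE : S c x = \tr (shape (X c) (N c) x *m newton_inf mu r (shape (X c) (N c) x)).
    rewrite /S shape_opE mxtrace_newton_inf.
    by rewrite !(sigma_infE (shape_split _ Uo Xs Xi cx)).
  rewrite SE (T_divE Uo Xs Ns Xi Nu No) //.
  by rewrite (T_hessE Uo Xs Xi Nu No).
(* S is recovered as the sum of (S N_a) N_a, because N has length 1. *)
have S0 c x : (forall a, S c x * N c x 0 a = 0) -> S c x = 0.
  move=> SN; rewrite -[LHS]mulr1 -(N_unit c x) /dot mxE mulr_sumr big1 // => a _.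
  by rewrite mulrA SN mul0r.
split; split=> [min a c cA x cx|eq c cA x cx].
- by have [-> _] := hess_div c x a cA cx; rewrite [S c x]min ?mul0r.
- by apply: S0 => a; have [<- _] := hess_div c x a cA cx; exact: eq.
- by have [_ ->] := hess_div c x a cA cx; rewrite [S c x]min ?mul0r.
- by apply: S0 => a; have [_ <-] := hess_div c x a cA cx; exact: eq.
Qed.
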